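(* Let $G$ be a locally compact compactly generated hyperbolic group whose Gromov boundary $\partial G$ is connected and contains at least two points. Then $G$ is not geometrically amenable.
   Context: For a locally compact group $G$ generated by a compact subset $S\subseteq G$, $d_S$ denotes the (left-invariant) word metric on $G$ with respect to $S$. $G$ is hyperbolic if $(G,d_S)$ is Gromov hyperbolic for some (equivalently, every) compact generating set $S$. A metric space $(X,d)$ is Gromov hyperbolic if for some $\delta\in[0,\infty)$ one has $(x|z)_w\ge\min\{(x|y)_w,(y|z)_w\}-\delta$ for all $x,y,z,w\in X$, where $(x|y)_w=\frac12(d(x,w)+d(y,w)-d(x,y))$. The boundary $\partial G$ is the Gromov boundary of $(G,d_S)$ with its usual topology (induced by any visual metric). Geometrically amenable: with $\lambda$ a left Haar measure on $G$, $G$ is geometrically amenable if for every compact subset $K\subseteq G$ and every $\varepsilon>0$ there is a compact subset $F\subseteq G$ with $\lambda(F)>0$ and $\lambda(FK)\le(1+\varepsilon)\lambda(F)$. Equivalently, $G$ is amenable and unimodular. *)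

(* Defs.v *)
From HB Require Import structures.
From mathcomp Require Import all_boot all_order all_algebra.
From mathcomp Require Import all_classical all_reals all_analysis.

Set Implicit Arguments.
Unset Strict Implicit.
Unset Printing Implicit Defensive.

Import Order.TTheory GRing.Theory Num.Theory.
Import numFieldNormedType.Exports.

Local Open Scope classical_set_scope.
Local Open Scope ring_scope.

(* Pointedness is no extra assumption on a group; measurable types need it. *)
HB.mixin Record isTopologicalGroup G & PointedTopological G & Group G := {
  mulg_continuous : continuous (fun xy : G * G => (xy.1 * xy.2)%g) ;
  invg_continuous : continuous (fun x : G => x^-1%g) }.

#[short(type="topologicalGroupType")]
HB.structure Definition TopologicalGroup :=
  {G of PointedTopological G & Group G & isTopologicalGroup G}.

Section metric_notions.
Context {R : realType} {X : Type}.
Implicit Types (d : X -> X -> R) (x y w : X) (u v : nat -> X).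

Definition is_metric d :=
  [/\ forall x y, d x y = 0 <-> x = y,
      forall x y, d x y = d y x &
      forall x y z, d x z <= d x y + d y z].

Definition metric_open d (U : set X) :=
  forall x, U x -> exists2 e : R, 0 < e & [set y | d x y < e] `<=` U.

Definition gromov_product d x y w : R := (d x w + d y w - d x y) / 2.

Definition gromov_hyperbolic d :=
  exists2 delta : R, 0 <= delta & forall x y z w,
    Num.min (gromov_product d x y w) (gromov_product d y z w) - delta
      <= gromov_product d x z w.

(* [(u_i | v_j)_w --> +oo] as [i, j --> oo]; the basepoint is immaterial. *)
Definition asymptotic d u v := forall w,
  gromov_product d (u ij.1) (v ij.2) w @[ij --> filter_prod \oo \oo] --> +oo.

Definition converges_to_infinity d u := asymptotic d u u.

Definition boundary_class d u : set (nat -> X) :=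
  [set v | converges_to_infinity d v /\ asymptotic d u v].

End metric_notions.

(* Points are the equivalence classes, as sets, of the sequences converging to
   infinity; [asymptotic] is transitive on these when [d] is hyperbolic. *)
Definition gromov_boundary (R : realType) (X : Type) (d : X -> X -> R) : Type :=
  set_type [set boundary_class d u | u in converges_to_infinity d].

HB.instance Definition _ (R : realType) (X : Type) (d : X -> X -> R) :=
  gen_eqMixin (gromov_boundary d).
HB.instance Definition _ (R : realType) (X : Type) (d : X -> X -> R) :=
  gen_choiceMixin (gromov_boundary d).

Section boundary.
Context {R : realType} {X : Type} (d : X -> X -> R).
Implicit Types (xi eta : gromov_boundary d).
Implicit Type rho : gromov_boundary d -> gromov_boundary d -> R.

(* Supremum over representatives of [liminf_(i, j) (u_i | v_j)_w]. *)
Definition boundary_product xi eta (w : X) : \bar R :=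
  ereal_sup [set limf_einf
      (fun ij : nat * nat => (gromov_product d (u ij.1) (v ij.2) w)%:E)
      (filter_prod \oo \oo)
    | u in set_val xi & v in set_val eta].

(* [rho] is comparable to [exp (- eps (xi | eta)_w)], where
   [expeR -oo = 0]. *)
Definition visual_metric rho :=
  is_metric rho /\
  exists w : X, exists eps c1 c2 : R,
    [/\ 0 < eps, 0 < c1, 0 < c2 & forall xi eta,
      let e := expeR (- (eps%:E * boundary_product xi eta w))%E in
      (c1%:E * e <= (rho xi eta)%:E <= c2%:E * e)%E].

(* For hyperbolic [d], visual metrics exist and all induce the same topology;
   quantifying over all of them yields a topology for an arbitrary [d]. *)
Definition boundary_open (U : set (gromov_boundary d)) :=
  forall rho, visual_metric rho -> metric_open rho U.

Lemma boundary_openT : boundary_open setT.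
Proof. by move=> rho _ x _; exists 1. Qed.

Lemma boundary_openI : setI_closed boundary_open.
Proof.
move=> A B oA oB rho vrho x [Ax Bx].
have [e e0 eA] := oA _ vrho _ Ax; have [f f0 fB] := oB _ vrho _ Bx.
exists (Num.min e f); first by rewrite lt_min e0.
by move=> y /=; rewrite lt_min => /andP[ye yf]; split; [exact: eA|exact: fB].
Qed.

Lemma boundary_open_bigU (I : Type) (f : I -> set (gromov_boundary d)) :
  (forall i, boundary_open (f i)) -> boundary_open (\bigcup_i f i).
Proof.
move=> of_ rho vrho x [i _ fix_].
have [e e0 ef] := of_ i _ vrho _ fix_.
by exists e => // y /ef fy; exists i.
Qed.

End boundary.

HB.instance Definition _ (R : realType) (X : Type) (d : X -> X -> R) :=
  isOpenTopological.Build (gromov_boundary d)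
    (@boundary_openT R X d) (@boundary_openI R X d) (@boundary_open_bigU R X d).

Section word_metric.
Context {G : groupType}.
Implicit Types (S : set G) (g : G).

Fixpoint word S (n : nat) : set G :=
  if n is m.+1 then
    [set (g * s)%g | g in word S m & s in S `|` [set t^-1%g | t in S]]
  else [set 1%g].

Definition generates S := forall g, exists n, word S n g.

Definition word_length S g : nat :=
  xget 0%N [set n | word S n g /\ forall m, word S m g -> (n <= m)%N].

Definition word_metric (R : realType) S (x y : G) : R :=
  (word_length S (x^-1 * y)%g)%:R.

End word_metric.

Notation borel G := (g_sigma_algebraType (@open G)).

Section haar.
Context {R : realType} {G : topologicalGroupType}.
Implicit Type lambda : {measure set (borel G) -> \bar R}.
Local Open Scope ereal_scope.

Definition left_haar_measure lambda :=
  [/\ lambda setT != 0,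
      forall (g : G) (A : set (borel G)), measurable A ->
        lambda [set (g * x)%g | x in A] = lambda A,
      forall K : set G, compact K -> lambda K < +oo,
      forall A : set (borel G), measurable A ->
        lambda A = ereal_inf
          [set lambda U | U in [set U : set G | open U /\ A `<=` U]] &
      forall U : set G, open U ->
        lambda U = ereal_sup
          [set lambda K | K in [set K : set G | compact K /\ K `<=` U]]].

Definition geometrically_amenable lambda :=
  forall (K : set G) (eps : R), compact K -> (0 < eps)%R ->
  exists F : set G, [/\ compact F, 0 < lambda F &
    lambda [set (x * y)%g | x in F & y in K] <= (1 + eps)%:E * lambda F].

End haar.

(* Main.v *)
Require Import Defs.
From mathcomp Require Import all_boot all_order all_algebra.
From mathcomp Require Import all_classical all_reals all_analysis.
From mathcomp Require Import zify lra.

Import Order.TTheory GRing.Theory Num.Theory.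

Local Open Scope classical_set_scope.
Local Open Scope ring_scope.

(** A two-point boundary is discrete, so a connected boundary with two points
    has three. Three boundary points give, by homogeneity, a tripod of any size
    centred at every [a] in [G]; at least two of its legs lead away from the
    identity, so that [a] has two "children" at height [|a| + L], and, by
    hyperbolicity, [2 ^ n] well separated descendants at height [|a| + n L].
    A descendant determines its ancestor up to a constant [c] independent of
    [n], hence a [c]-separated subset [s] of a compact set [F] has
    [2 ^ n * size s] separated descendants in a bounded neighbourhood of [F].
    For [s] maximal, [lambda F] is at most [size s] times the measure of a ball
    of radius [c], which contradicts geometric amenability for large [n]. *)

(** * Gromov products in a hyperbolic metric space *)

Section hyperbolic_metric.
Context {R : realType} {X : eqType} (d : X -> X -> R) (delta : R).
Hypothesis d_metric : is_metric d.
Hypothesis delta_ge0 : 0 <= delta.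
Hypothesis d_hyperbolic : forall x y z w,
  Num.min (gromov_product d x y w) (gromov_product d y z w) - delta
    <= gromov_product d x z w.

Local Notation gp := (gromov_product d).

Let d0 x : d x x = 0. Proof. by case: d_metric => d0 _ _; apply/d0. Qed.
Let dC x y : d x y = d y x. Proof. by case: d_metric. Qed.
Let dT x y z : d x z <= d x y + d y z. Proof. by case: d_metric. Qed.

Lemma gromov_productC x y w : gp x y w = gp y x w.
Proof. by rewrite /gromov_product (dC x y); lra. Qed.

Lemma hyperbolic_or x y z w :
  gp x y w <= gp x z w + delta \/ gp y z w <= gp x z w + delta.
Proof.
have := d_hyperbolic x y z w.
by rewrite minElt; case: ifP => _ ?; [left|right]; lra.
Qed.

Lemma gromov_product_le_dist x y w : gp x y w <= d x w.
Proof. by rewrite /gromov_product; have := dT y x w; rewrite (dC y x); lra. Qed.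

Lemma gromov_product_base x y w w' : gp x y w <= gp x y w' + d w' w.
Proof.
by rewrite /gromov_product; have := dT x w' w; have := dT y w' w; lra.
Qed.

Lemma gromov_product_move x x' y w : gp x' y w <= gp x y w + d x x'.
Proof.
rewrite /gromov_product; have := dT x' x w; have := dT x x' y.
by rewrite (dC x' x); lra.
Qed.

(** The hypothesis puts [x'] on a geodesic from [w] to [x]; the legs of a tripod at [w] can
    therefore be truncated without spoiling upper bounds on products. *)
Lemma gromov_product_prefix x x' y w :
  d w x = d w x' + d x' x -> gp x' y w <= gp x y w.
Proof.
rewrite /gromov_product (dC x w) (dC x' w) => ->; have := dT x x' y.
by rewrite (dC x x'); lra.
Qed.

(** The comparison tripod of the triangle [w], [x], [y] cuts the side from [w] to [x] into pieces of
    these two lengths. *)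
Lemma gromov_productDr w x y : gp x y w + gp w y x = d x w.
Proof. by rewrite /gromov_product (dC w x) (dC y w) (dC y x); lra. Qed.

(** * Exponential branching of descendants *)

Section branching.
Variables (w : X) (C L r : R).
Hypotheses (C_ge0 : 0 <= C) (r_ge0 : 0 <= r).
Hypothesis L_large : 4 * C + 8 * delta + r < L.
Hypothesis two_children : forall a, exists c1 c2,
  [/\ d w c1 = d w a + L, d w c2 = d w a + L,
      gp w c1 a <= C, gp w c2 a <= C & gp c1 c2 a <= C].

(** Since [gp a w c] is at least [L - C], hyperbolicity at [c] bounds [gp z a c] by [C + 2 * delta],
    so [z] leaves [a] in the direction of [c]. Hyperbolicity at [a] then gives back the same bound
    [C + delta]: errors do not accumulate over generations. *)
Lemma child_descendant a c z : d w c = d w a + L -> gp w c a <= C ->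
  gp w z c <= C + delta ->
  gp w z a <= C + delta /\ L - C - 2 * delta <= gp z c a.
Proof.
have [? ? ? ?] : [/\ 0 <= delta, 0 <= C, 0 <= r &
  4 * C + 8 * delta + r < L] by [].
move=> hc gc gz; have dac : L <= d a c by have := dT w a c; lra.
have e1 := gromov_productDr c a w; have e2 := gromov_productDr a c z.
rewrite (gromov_productC a w) (gromov_productC c w) in e1.
rewrite (gromov_productC a z) in e2.
have ez : gp c z a = gp z c a := gromov_productC _ _ _.
have ec : d c a = d a c := dC _ _.
have zL : L - C - 2 * delta <= gp z c a.
  have [|] := hyperbolic_or z a w c; rewrite (gromov_productC z w).
    by move=> ?; lra.
  by rewrite (gromov_productC a w) => ?; lra.
split=> //; have [|] := hyperbolic_or w z c a; lra.
Qed.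

(** Following [c1] and [c2], which diverge near [a], forces [gp z1 z2 a <= C + 2 * delta], while
    both points are at distance at least [L - C - 2 * delta] from [a]. *)
Lemma descendants_separated a c1 c2 z1 z2 : gp c1 c2 a <= C ->
  L - C - 2 * delta <= gp z1 c1 a -> L - C - 2 * delta <= gp z2 c2 a ->
  r < d z1 z2.
Proof.
have [? ? ? ?] : [/\ 0 <= delta, 0 <= C, 0 <= r &
  4 * C + 8 * delta + r < L] by [].
move=> g12 g1 g2.
have h1 := gromov_product_le_dist z1 c1 a.
have h2 := gromov_product_le_dist z2 c2 a.
have g1' : gp c1 z2 a <= C + delta.
  have [|] := hyperbolic_or c1 z2 c2 a; lra.
have g1'' : gp z1 z2 a <= C + 2 * delta.
  have [|] := hyperbolic_or c1 z1 z2 a; rewrite ?(gromov_productC c1 z1); lra.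
by move: g1''; rewrite {1}/gromov_product; lra.
Qed.

(* [a] is coarsely between [w] and [z]. Prescribing the height [d w z] exactly
   makes [a] determined by [z] up to an error that does not grow with [n]. *)
Definition descendant n a z :=
  d w z = d w a + n%:R * L /\ gp w z a <= C + delta.

Lemma descendantS n a c z : d w c = d w a + L -> gp w c a <= C ->
  descendant n c z -> descendant n.+1 a z.
Proof.
move=> hc gc [hz gz]; split; last by have [] := child_descendant a c z hc gc gz.
by rewrite hz hc -natr1 mulrDl mul1r addrAC addrA.
Qed.

Lemma many_descendants n a : exists s : seq X,
  [/\ size s = (2 ^ n)%N, {in s, forall z, descendant n a z} &
      pairwise (fun x y => r < d x y) s].
Proof.
have [? ? ?] : [/\ 0 <= delta, 0 <= C & 0 <= r] by [].
elim: n a => [|n IHn] a.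
  exists [:: a]; split=> // z; rewrite inE => /eqP ->; split.
    by rewrite mul0r addr0.
  by rewrite /gromov_product d0; lra.
have [c1 [c2 [h1 h2 g1 g2 g12]]] := two_children a.
have [s1 [sz1 s1D s1r]] := IHn c1; have [s2 [sz2 s2D s2r]] := IHn c2.
exists (s1 ++ s2); split.
- by rewrite size_cat sz1 sz2 expnS mul2n addnn.
- by move=> z; rewrite mem_cat => /orP[/s1D|/s2D]; exact: descendantS.
rewrite pairwise_cat s1r s2r !andbT; apply/allrelP => z1 z2 /s1D[_ b1] /s2D[_ b2].
have [_ k1] := child_descendant a c1 z1 h1 g1 b1.
have [_ k2] := child_descendant a c2 z2 h2 g2 b2.
exact: (descendants_separated a c1 c2).
Qed.

(** As [n] is the same, the heights of [a] and [a'] differ by at most [r]. Seen from [w], both have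
    almost maximal product with [z], hence with each other. One [r] comes from the heights, two from
    replacing [z'] by [z]. *)
Lemma common_descendant n a a' z z' :
  descendant n a z -> descendant n a' z' -> d z z' <= r ->
  d a a' <= 2 * C + 4 * delta + 3 * r.
Proof.
have [? ? ?] : [/\ 0 <= delta, 0 <= C & 0 <= r] by [].
move=> [hz gz] [hz' gz'] zr.
have e1 := gromov_productDr w a z; have e2 := gromov_productDr w a' z'.
rewrite (dC a w) in e1; rewrite (dC a' w) in e2.
have m := gromov_product_move z z' a' w.
have t1 := dT w z z'; have t2 := dT w z' z; rewrite (dC z' z) in t2.
have gE : d a a' = d w a + d w a' - 2 * gp a a' w.
  by rewrite /gromov_product (dC a w) (dC a' w); lra.
have [|] := hyperbolic_or a z a' w; first by lra.
rewrite (gromov_productC z' a') in m; lra.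
Qed.

(** By [common_descendant], descendants of different points of [s] are more than [r] apart, so the
    families can be concatenated. *)
Lemma spread_descendants n (s : seq X) :
  pairwise (fun x y => 2 * C + 4 * delta + 3 * r < d x y) s ->
  exists t : seq X,
  [/\ size t = (2 ^ n * size s)%N,
      {in t, forall z, exists2 a, a \in s & descendant n a z} &
      pairwise (fun x y => r < d x y) t].
Proof.
elim: s => [_|a s IHs /=]; first by exists [::]; split; rewrite ?muln0.
case/andP => /allP far /IHs[t [szt tD tr]].
have [u [szu uD ur]] := many_descendants n a.
exists (u ++ t); split.
- by rewrite size_cat szu szt mulnS.
- move=> z; rewrite mem_cat => /orP[/uD zD|/tD[b bs zD]].
    by exists a => //; rewrite mem_head.
  by exists b => //; rewrite inE bs orbT.
rewrite pairwise_cat ur tr !andbT; apply/allrelP => z z' /uD zD /tD[b bs z'D].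
rewrite ltNge; apply/negP => /(common_descendant n a b z z' zD z'D).
by rewrite leNgt far.
Qed.

End branching.

(** * Sequences converging to infinity and boundary points *)

Lemma asymptoticP u v : asymptotic d u v <-> forall w A, exists N,
  forall i j, (N <= i)%N -> (N <= j)%N -> A <= gp (u i) (v j) w.
Proof.
split=> uv w; last first.
  apply/cvgryPge => A; have [N hN] := uv w A.
  exists ([set n | (N <= n)%N], [set n | (N <= n)%N]) => /=.
    by split; exists N.
  by move=> [i j] [/= Ni Nj]; exact: hN.
move=> A; have /cvgryPge/(_ A)[[P Q] /= [[N1 _ P1] [N2 _ Q1]] PQ] := uv w.
exists (maxn N1 N2) => i j; rewrite !geq_max => /andP[i1 _] /andP[_ j2].
by apply: (PQ (i, j)); split; [exact: P1|exact: Q1].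
Qed.

Lemma asymptotic_sym u v : asymptotic d u v -> asymptotic d v u.
Proof.
move=> /asymptoticP uv; apply/asymptoticP => w A; have [N hN] := uv w A.
by exists N => i j Ni Nj; rewrite gromov_productC; exact: hN.
Qed.

Lemma asymptotic_trans u v t :
  asymptotic d u v -> asymptotic d v t -> asymptotic d u t.
Proof.
move=> /asymptoticP uv /asymptoticP vt; apply/asymptoticP => w A.
have [N1 h1] := uv w (A + delta); have [N2 h2] := vt w (A + delta).
exists (maxn N1 N2) => i j; rewrite !geq_max => /andP[i1 i2] /andP[j1 j2].
have k1 := h1 i (maxn N1 N2) i1 (leq_maxl _ _).
have k2 := h2 (maxn N1 N2) j (leq_maxr _ _) j2.
have [|] := hyperbolic_or (u i) (v (maxn N1 N2)) (t j) w; lra.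
Qed.

Lemma boundary_class_asymptotic u v :
  asymptotic d u v -> boundary_class d u = boundary_class d v.
Proof.
move=> uv; rewrite eqEsubset; split=> t [ct ut]; split=> //.
  exact: asymptotic_trans _ _ _ (asymptotic_sym _ _ uv) ut.
exact: asymptotic_trans _ _ _ uv ut.
Qed.

(** Failure of asymptoticity gives one late pair with product below [A]. Late terms of [u] have
    large products with one another, and so do those of [v], so two uses of hyperbolicity carry the
    bound to all late pairs. Changing the base point costs [d w w0]. *)
Lemma not_asymptotic_bounded u v w0 :
  converges_to_infinity d u -> converges_to_infinity d v ->
  ~ asymptotic d u v -> exists C N, forall i j, (N <= i)%N -> (N <= j)%N ->
    gp (u i) (v j) w0 <= C.
Proof.
have ? : 0 <= delta by [].
move=> /asymptoticP cu /asymptoticP cv.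
move=> /asymptoticP/existsNP[w /existsNP[A /forallNP uv]].
have [N1 h1] := cu w (A + 3 * delta); have [N2 h2] := cv w (A + 3 * delta).
pose N := maxn N1 N2; have [i0 [j0 [Ni0 Nj0 g0]]] : exists i0 j0,
    [/\ (N <= i0)%N, (N <= j0)%N & gp (u i0) (v j0) w < A].
  move: (uv N) => /existsNP[i /existsNP[j /not_implyP[Ni /not_implyP[Nj /negP]]]].
  by rewrite -ltNge => g; exists i, j.
exists (A + 2 * delta + d w w0), N => i j Ni Nj.
have uu := h1 i0 i (leq_trans (leq_maxl _ _) Ni0) (leq_trans (leq_maxl _ _) Ni).
have vv := h2 j j0 (leq_trans (leq_maxr _ _) Nj) (leq_trans (leq_maxr _ _) Nj0).
have := gromov_product_base (u i) (v j) w0 w.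
have [|] := hyperbolic_or (u i0) (u i) (v j) w;
have [|] := hyperbolic_or (u i0) (v j) (v j0) w; lra.
Qed.

Lemma boundary_points_diverge (xi eta : gromov_boundary d) u v w :
  xi <> eta -> converges_to_infinity d u -> converges_to_infinity d v ->
  boundary_class d u = set_val xi -> boundary_class d v = set_val eta ->
  exists C N, forall i j, (N <= i)%N -> (N <= j)%N -> gp (u i) (v j) w <= C.
Proof.
move=> xe cu cv ux ve; apply: not_asymptotic_bounded => // uv; apply: xe.
apply: val_inj; change (set_val xi = set_val eta).
by rewrite -ux -ve; exact: boundary_class_asymptotic.
Qed.

Lemma three_rays w (xi1 xi2 xi3 : gromov_boundary d) :
  xi1 <> xi2 -> xi1 <> xi3 -> xi2 <> xi3 -> exists C, forall K,
  exists x1 x2 x3, [/\ K <= d w x1, K <= d w x2 & K <= d w x3] /\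
    [/\ gp x1 x2 w <= C, gp x1 x3 w <= C & gp x2 x3 w <= C].
Proof.
move=> n12 n13 n23.
have [u1 c1 e1] := set_valP xi1; have [u2 c2 e2] := set_valP xi2.
have [u3 c3 e3] := set_valP xi3.
have [C12 [N12 h12]] := boundary_points_diverge _ _ _ _ w n12 c1 c2 e1 e2.
have [C13 [N13 h13]] := boundary_points_diverge _ _ _ _ w n13 c1 c3 e1 e3.
have [C23 [N23 h23]] := boundary_points_diverge _ _ _ _ w n23 c2 c3 e2 e3.
exists (Num.max C12 (Num.max C13 C23)) => K.
have far u : converges_to_infinity d u ->
    exists N, forall i, (N <= i)%N -> K <= d w (u i).
  move=> /asymptoticP/(_ w K)[N hN]; exists N => i Ni.
  rewrite dC; apply: le_trans (hN i i Ni Ni) _.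
  exact: gromov_product_le_dist.
have [M1 f1] := far _ c1; have [M2 f2] := far _ c2; have [M3 f3] := far _ c3.
pose N := (N12 + N13 + N23 + M1 + M2 + M3)%N.
exists (u1 N), (u2 N), (u3 N); split; split.
- by apply: f1; lia.
- by apply: f2; lia.
- by apply: f3; lia.
- by rewrite !le_max h12 //; lia.
- by rewrite !le_max h13 ?orbT //; lia.
- by rewrite !le_max h23 ?orbT //; lia.
Qed.

End hyperbolic_metric.

(** If [a] and [b] were the only points, the ball of radius [rho a b] about [a] would be [{a}] for
    every visual metric [rho]. Both singletons would be open, and [{xi}] a proper nonempty clopen
    set. *)
Lemma connected_boundary_third_point (R : realType) (X : Type) (d : X -> X -> R)
    (xi eta : gromov_boundary d) :
  connected [set: gromov_boundary d] -> xi <> eta ->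
  exists zeta, xi <> zeta /\ eta <> zeta.
Proof.
move=> conn xe; apply: contrapT => /forallNP two.
have dich zeta : zeta = xi \/ zeta = eta.
  have [->|zx] := pselect (zeta = xi); first by left.
  right; apply: contrapT => ze; apply: (two zeta).
  by split => e; [apply: zx|apply: ze].
have isolated (a b : gromov_boundary d) :
    (forall z, z = a \/ z = b) -> a <> b -> boundary_open [set a].
  move=> ab anb rho [[rho0 rhoC rhoT] _] x /= ->.
  exists (rho a b).
    have := rhoT a b a; rewrite (rhoC b a) (rho0 a a).2 // => ab0.
    rewrite lt_neqAle; apply/andP; split; last by lra.
    by apply/eqP => /esym/rho0.
  by move=> y /=; case: (ab y) => -> //; rewrite ltxx.
suff /seteqP[_ /(_ eta I)] : [set xi] = [set: gromov_boundary d] by move/esym.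
apply: conn; first by exists xi.
  by exists [set xi]; [exact: (isolated xi eta)|rewrite setTI].
exists (~` [set eta]).
  apply: open_closedC; apply: (isolated eta xi); last exact/nesym.
  by move=> z; case: (dich z); [right|left].
by rewrite setTI; apply/seteqP; split=> z /= => [->|ze] //; case: (dich z).
Qed.

(** * Word metrics, tripods and children in a group *)

Section word_length_theory.
Context {G : groupType} (S : set G).
Hypothesis S_generates : generates S.
Implicit Types x y g h : G.

Local Notation len := (word_length S).

(** Generation makes the set in [word_length] nonempty, so the default value [0] of [xget] does not
    intervene. *)
Lemma word_lengthP g :
  word S (len g) g /\ forall n, word S n g -> (len g <= n)%N.
Proof.
have [n0 n0g] := S_generates g.
have exW : exists n, `[< word S n g >] by exists n0; apply/asboolP.
have [m /asboolP mg m_min] := ex_minnP exW.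
rewrite /word_length; case: xgetP => [_ -> //|/(_ m) []]; split=> // n ng.
by apply: m_min; apply/asboolP.
Qed.

Lemma word_cat m n x y : word S m x -> word S n y -> word S (m + n) (x * y)%g.
Proof.
move=> mx; elim: n y => [|n IHn] y /=; first by move=> ->; rewrite addn0 mulg1.
move=> [z nz [s Ss <-]]; rewrite addnS mulgA /=.
by exists (x * z)%g; [exact: IHn|exists s].
Qed.

Lemma word_split m n z : word S (m + n) z ->
  exists x y, [/\ word S m x, word S n y & z = (x * y)%g].
Proof.
elim: n z => [|n IHn] z; first by rewrite addn0; exists z, 1%g; rewrite mulg1.
rewrite addnS => -[z' /IHn[x [y [mx ny ->]]] [s Ss <-]].
by exists x, (y * s)%g; split; rewrite ?mulgA //; exists y => //; exists s.
Qed.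

Lemma word_inv n x : word S n x -> word S n x^-1%g.
Proof.
elim: n x => [|n IHn] x; first by move=> /= ->; rewrite invg1.
move=> [z /IHn nz [s Ss <-]]; rewrite invgM -add1n; apply: word_cat => //=.
exists 1%g => //; exists s^-1%g; last by rewrite mul1g.
by case: Ss => [Ss|[t St <-]]; [right; exists s|left; rewrite invgK].
Qed.

Lemma word_length1 : len 1%g = 0%N.
Proof. by apply/eqP; rewrite -leqn0; apply: (word_lengthP 1%g).2. Qed.

Lemma word_length_eq0 g : len g = 0%N -> g = 1%g.
Proof. by move=> g0; have [+ _] := word_lengthP g; rewrite g0. Qed.

Lemma word_lengthM x y : (len (x * y)%g <= len x + len y)%N.
Proof.
by apply: (word_lengthP _).2; apply: word_cat; apply: (word_lengthP _).1.
Qed.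

Lemma word_lengthV x : len x^-1%g = len x.
Proof.
have le_inv z : (len z^-1%g <= len z)%N.
  by apply: (word_lengthP _).2; apply: word_inv; apply: (word_lengthP _).1.
by apply/eqP; rewrite eqn_leq le_inv -{1}(invgK x) le_inv.
Qed.

(** A shortest word for [g] is cut after [k] letters; a shorter word for either piece would shorten
    [g]. Such prefixes serve as points on geodesics. *)
Lemma word_length_prefix k g : (k <= len g)%N ->
  exists h, len h = k /\ len (h^-1 * g)%g = (len g - k)%N.
Proof.
move=> kg; have [+ _] := word_lengthP g.
rewrite -(subnKC kg) => /word_split[x [y [kx ky gE]]]; exists x.
have lx := (word_lengthP x).2 _ kx; have ly := (word_lengthP y).2 _ ky.
have := word_lengthM x y; rewrite -gE => lxy.
by rewrite gE mulKg -gE; split; lia.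
Qed.

Variable R : realType.
Local Notation d := (word_metric R S).

Lemma word_metric_is_metric : is_metric d.
Proof.
split=> [x y|x y|x y z]; rewrite /word_metric.
- split=> [/eqP|->]; last by rewrite mulVg word_length1.
  rewrite pnatr_eq0 => /eqP/word_length_eq0 e.
  by rewrite -[y](mulVKg x) e mulg1.
- by rewrite -word_lengthV invgM invgK.
rewrite -natrD ler_nat; have := word_lengthM (x^-1 * y) (y^-1 * z)%g.
by rewrite mulgA mulgK.
Qed.

Lemma word_metricM g x y : d (g * x)%g (g * y)%g = d x y.
Proof. by rewrite /word_metric invgM mulgA mulgVK. Qed.

Lemma gromov_productM g x y w :
  gromov_product d (g * x)%g (g * y)%g (g * w)%g = gromov_product d x y w.
Proof. by rewrite /gromov_product !word_metricM. Qed.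

Lemma word_metric1 g : d 1%g g = (len g)%:R.
Proof. by rewrite /word_metric invg1 mul1g. Qed.

(** The far points of [three_rays] are replaced by prefixes of length exactly [K], which does not
    increase their products. *)
Lemma tripod (xi1 xi2 xi3 : gromov_boundary d) : gromov_hyperbolic d ->
  xi1 <> xi2 -> xi1 <> xi3 -> xi2 <> xi3 -> exists C : R, forall K : nat,
  exists p1 p2 p3, [/\ len p1 = K, len p2 = K & len p3 = K] /\
    [/\ gromov_product d p1 p2 1%g <= C, gromov_product d p1 p3 1%g <= C &
        gromov_product d p2 p3 1%g <= C].
Proof.
move=> [delta delta0 hyp] n12 n13 n23; have dm := word_metric_is_metric.
have [C hC] := three_rays d delta dm delta0 hyp 1%g _ _ _ n12 n13 n23.
exists C => K; have [x1 [x2 [x3 [[]]]]] := hC K%:R.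
rewrite !word_metric1 !ler_nat => K1 K2 K3 [g12 g13 g23].
have [p1 [l1 q1]] := word_length_prefix _ _ K1.
have [p2 [l2 q2]] := word_length_prefix _ _ K2.
have [p3 [l3 q3]] := word_length_prefix _ _ K3.
have prefix x p : (K <= len x)%N -> len p = K -> len (p^-1 * x)%g = (len x - K)%N ->
    d 1%g x = d 1%g p + d p x.
  by move=> Kx lp lpx; rewrite !word_metric1 /word_metric lp lpx -natrD subnKC.
have shrink x x' y y' : d 1%g x = d 1%g x' + d x' x -> d 1%g y = d 1%g y' + d y' y ->
    gromov_product d x y 1%g <= C -> gromov_product d x' y' 1%g <= C.
  move=> ex ey; apply: le_trans.
  apply: le_trans (gromov_product_prefix d dm _ _ _ _ ex).
  rewrite !(gromov_productC d dm x').
  exact: (gromov_product_prefix d dm _ _ _ _ ey).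
exists p1, p2, p3; split; split=> //.
- by apply: shrink g12; exact: prefix.
- by apply: shrink g13; exact: prefix.
- by apply: shrink g23; exact: prefix.
Qed.

(** A tripod at the identity is translated to [a]; before the translation, [a^-1] stands for the
    identity. Geodesics from [1] to the ends of two legs leading away are cut at height exactly
    [|a| + L]. *)
Lemma word_metric_two_children (xi1 xi2 xi3 : gromov_boundary d) :
  gromov_hyperbolic d -> xi1 <> xi2 -> xi1 <> xi3 -> xi2 <> xi3 ->
  exists2 C : R, 0 <= C & forall (L : nat) a, exists c1 c2,
    [/\ d 1%g c1 = d 1%g a + L%:R, d 1%g c2 = d 1%g a + L%:R,
        gromov_product d 1%g c1 a <= C, gromov_product d 1%g c2 a <= C &
        gromov_product d c1 c2 a <= C].
Proof.
move=> hypd n12 n13 n23; have dm := word_metric_is_metric.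
have [C0 hC0] := tripod _ _ _ hypd n12 n13 n23.
have [delta delta0 hyp] := hypd.
have [_ dC dT] := dm.
pose c := Num.bound (Num.max 0 (C0 + delta)).
have c_gt : C0 + delta < c%:R /\ C0 < c%:R.
  have : Num.max 0 (C0 + delta) < c%:R.
    by apply: le_lt_trans (archi_boundP _); rewrite ?ler_norm // le_max lexx.
  by rewrite gt_max => /andP[? ?]; split; lra.
(* One [c] bounds [C0]; each child is within [2 * c] of the end of its leg, which adds four more. *)
exists (5 * c%:R); first by rewrite mulr_ge0.
move=> L a; have [p1 [p2 [p3 [[l1 l2 l3] [g12 g13 g23]]]]] := hC0 (L + 2 * c)%N.
(* At most one leg of the tripod can point towards [1] as seen from [a]. *)
have [p [q [lp lq gpa gqa gpq]]] : exists p q,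
  [/\ len p = (L + 2 * c)%N, len q = (L + 2 * c)%N,
      gromov_product d a^-1%g p 1%g <= c%:R, gromov_product d a^-1%g q 1%g <= c%:R &
      gromov_product d p q 1%g <= C0].
  have side x y : gromov_product d x y 1%g <= C0 ->
      gromov_product d a^-1%g x 1%g <= c%:R \/ gromov_product d a^-1%g y 1%g <= c%:R.
    move=> gxy; have [h|h] := hyperbolic_or d delta hyp x a^-1%g y 1%g.
      by left; rewrite (gromov_productC d dm); lra.
    by right; lra.
  have [h1|h1] := side _ _ g12; have [h2|h2] := side _ _ g13;
    have [h3|h3] := side _ _ g23;
    first [by exists p1, p2|by exists p1, p3|by exists p2, p3].
have child x : len x = (L + 2 * c)%N -> gromov_product d a^-1%g x 1%g <= c%:R ->
    exists z, [/\ d 1%g z = d 1%g a + L%:R, gromov_product d 1%g z a <= 5 * c%:R &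
      d (a * x)%g z <= 2 * c%:R].
  move=> lx gx; have dax : d a (a * x)%g = L%:R + 2 * c%:R.
    by rewrite -{1}[a]mulg1 word_metricM word_metric1 lx natrD natrM.
  (* A product of at most [c] costs at most [2 * c] of height, which is the surplus in the length of
     the leg. *)
  have hax : d 1%g a + L%:R <= d 1%g (a * x)%g.
    move: gx; rewrite -(gromov_productM a) mulgV mulg1 /gromov_product.
    by rewrite (dC (a * x)%g a) dax; lra.
  have : (len a + L <= len (a * x)%g)%N.
    by move: hax; rewrite !word_metric1 -natrD ler_nat.
  move=> /[dup] le_len /word_length_prefix[z [lz lzax]]; exists z.
  have hz : d 1%g z = d 1%g a + L%:R by rewrite !word_metric1 lz natrD.
  have dzax : d (a * x)%g z <= 2 * c%:R.
    rewrite dC /word_metric lzax natrB // natrD -!word_metric1.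
    by have := dT 1%g a (a * x)%g; lra.
  split=> //; rewrite /gromov_product (dC z a) hz.
  by have := dT a (a * x)%g z; have := ler0n R c; lra.
have [z1 [h1 g1 e1]] := child p lp gpa; have [z2 [h2 g2 e2]] := child q lq gqa.
exists z1, z2; split=> //.
have := gromov_product_move d dm (a * p)%g z1 z2 a.
have := gromov_product_move d dm (a * q)%g z2 (a * p)%g a.
rewrite (gromov_productC d dm z2) (gromov_productC d dm (a * q)%g).
have := gromov_productM a p q 1%g; rewrite mulg1 => ->.
by have := ler0n R c; lra.
Qed.

End word_length_theory.

(** * Haar measure and packing by word balls *)

Section haar_packing.
Context {R : realType} {G : topologicalGroupType} (S : set G).
Variable lambda : {measure set (borel G) -> \bar R}.
Hypothesis G_hausdorff : hausdorff_space G.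
Hypothesis S_compact : compact S.
Hypothesis S_generates : generates S.
Hypothesis lambda_haar : left_haar_measure lambda.
Implicit Types (x y g : G) (s : seq G) (A B F K : set G).

Local Notation len := (word_length S).

Lemma compact_mulg A B : compact A -> compact B ->
  compact [set (x * y)%g | x in A & y in B].
Proof.
move=> cA cB; have -> : [set (x * y)%g | x in A & y in B] =
    [set (xy.1 * xy.2)%g | xy in A `*` B].
  apply/seteqP; split=> z /=.
    by move=> [x Ax [y By <-]]; exists (x, y).
  by move=> [[x y] [/= Ax By] <-]; exists x => //; exists y.
apply: continuous_compact; last exact: compact_setX.
exact/continuous_subspaceT/mulg_continuous.
Qed.

Lemma compact_word n : compact (word S n).
Proof.
elim: n => [|n IHn] /=; first exact: compact_set1.
apply: compact_mulg => //; apply: compactU => //.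
apply: continuous_compact => //.
exact/continuous_subspaceT/invg_continuous.
Qed.

(** The sets [word S n] need not increase with [n], whereas balls do. *)
Definition word_ball n : set G := [set g | (len g <= n)%N].

Lemma compact_word_ball n : compact (word_ball n).
Proof.
elim: n => [|n IHn].
  rewrite (_ : word_ball 0 = [set 1%g]); first exact: compact_set1.
  apply/seteqP; split=> g /=; rewrite /word_ball /=.
    by rewrite leqn0 => /eqP/(word_length_eq0 S S_generates).
  by move=> ->; rewrite (word_length1 S S_generates).
rewrite (_ : word_ball n.+1 = word_ball n `|` word S n.+1).
  by apply: compactU => //; exact: compact_word.
apply/seteqP; split=> g; rewrite /word_ball /=.
  rewrite leq_eqVlt => /orP[/eqP e|]; last by rewrite ltnS; left.
  by right; have [+ _] := word_lengthP S S_generates g; rewrite e.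
by case=> [|gn]; [exact: leqW|exact: (word_lengthP S S_generates g).2].
Qed.

Lemma compact_measurable A : compact A -> measurable (A : set (borel G)).
Proof.
move=> /(compact_closed G_hausdorff) cA; rewrite -[A]setCK.
by apply: measurableC; apply: sub_sigma_algebra; exact: closed_openC.
Qed.

Lemma haar_compact_fin K : compact K -> lambda K \is a fin_num.
Proof.
by case: lambda_haar => _ _ + _ _ => /[apply] fK; rewrite ge0_fin_numE.
Qed.

Lemma compact_translate x A : compact A -> compact [set (x * y)%g | y in A].
Proof.
move=> cA; rewrite (_ : image _ _ = [set (z * y)%g | z in [set x] & y in A]).
  by apply: compact_mulg => //; exact: compact_set1.
apply/seteqP; split=> z /= [y].
  by move=> Ay <-; exists x => //; exists y.
by move=> -> [t At <-]; exists t.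
Qed.

Definition ball_union n s : set G :=
  [set z | exists2 x, x \in s & word_ball n (x^-1 * z)%g].

Lemma ball_union_nil n : ball_union n [::] = set0.
Proof. by apply/seteqP; split=> z // [x]. Qed.

Lemma ball_union_cons n x s :
  ball_union n (x :: s) = [set (x * y)%g | y in word_ball n] `|` ball_union n s.
Proof.
apply/seteqP; split=> z /=.
  move=> [y]; rewrite inE => /orP[/eqP ->|ys] yz; last by right; exists y.
  by left; exists (x^-1 * z)%g => //; rewrite mulVKg.
move=> [[y ny <-]|[y ys yz]]; first by exists x; rewrite ?mem_head ?mulKg.
by exists y; rewrite // inE ys orbT.
Qed.

Lemma compact_ball_union n s : compact (ball_union n s).
Proof.
elim: s => [|x s IHs]; first by rewrite ball_union_nil; exact: compact0.
rewrite ball_union_cons; apply: compactU => //.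
exact/compact_translate/compact_word_ball.
Qed.

Lemma haar_translate_ball x n :
  lambda [set (x * y)%g | y in word_ball n] = lambda (word_ball n).
Proof.
case: lambda_haar => _ inv _ _ _; apply: inv.
by apply: compact_measurable; exact: compact_word_ball.
Qed.

Lemma haar_ball_union_le n s :
  (lambda (ball_union n s) <= (size s)%:R%:E * lambda (word_ball n))%E.
Proof.
elim: s => [|x s IHs]; first by rewrite ball_union_nil measure0 mul0e.
rewrite ball_union_cons -(haar_translate_ball x) /= -natr1 addrC EFinD.
rewrite ge0_muleDl // mul1e.
apply: le_trans (measureU2 _ _ _) _.
- by apply: compact_measurable; apply: compact_translate; exact: compact_word_ball.
- by apply: compact_measurable; exact: compact_ball_union.
by apply: leeD => //; rewrite haar_translate_ball.
Qed.

(** The translated balls are disjoint: a common point of those about [x] and [z] would make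
    [x^-1 * z] a product of two elements of length at most [n]. *)
Lemma haar_ball_union_separated n s :
  pairwise (fun x y => (2 * n < len (x^-1 * y)%g)%N) s ->
  lambda (ball_union n s) = ((size s)%:R%:E * lambda (word_ball n))%E.
Proof.
elim: s => [_|x s IHs /= /andP[/allP far /IHs {}IHs]].
  by rewrite ball_union_nil measure0 mul0e.
rewrite ball_union_cons -natr1 addrC EFinD ge0_muleDl // mul1e -IHs.
rewrite -(haar_translate_ball x) measureU //.
- by apply: compact_measurable; apply: compact_translate; exact: compact_word_ball.
- by apply: compact_measurable; exact: compact_ball_union.
apply/seteqP; split=> // _ [[y ny <-] [z /far + nz]] /=.
have -> : (x^-1 * z = y * (z^-1 * (x * y))^-1)%g.
  by rewrite !invgM invgK !mulgA mulgV mul1g.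
rewrite ltnNge => /negP; apply; apply: leq_trans (word_lengthM S S_generates _ _) _.
by rewrite (word_lengthV S S_generates) mul2n -addnn leq_add.
Qed.

(** Countably many balls cover [G]; if all were null, so would be [G]. *)
Lemma haar_word_ball_gt0 : exists n, (0 < lambda (word_ball n))%E.
Proof.
apply: contrapT => /forallNP null; case: lambda_haar => + _ _ _ _; apply/negP.
rewrite negbK eq_le measure_ge0 andbT.
apply: le_trans (measure_sigma_subadditive lambda (F := word_ball) _ _ _) _ => //.
- by move=> n; apply: compact_measurable; exact: compact_word_ball.
- by move=> g _; exists (len g) => //; rewrite /word_ball /=.
rewrite eseries0 // => n _ _; apply/eqP; rewrite eq_le measure_ge0 andbT leNgt.
exact/negP.
Qed.

Lemma ball_union_subset n s F K : {in s, forall x, F x} ->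
  word_ball n `<=` K ->
  ball_union n s `<=` [set (x * y)%g | x in F & y in K].
Proof.
move=> sF nK z [x /sF Fx /nK Kz]; exists x => //.
by exists (x^-1 * z)%g => //; rewrite mulVKg.
Qed.

(* The measure of [F * word_ball m] bounds the size of the [c]-separated
   subsets of [F], so that a largest one exists. *)
Lemma compact_net F m c : compact F -> (0 < lambda (word_ball m))%E ->
  (2 * m <= c)%N -> exists s, [/\ {in s, forall x, F x},
    pairwise (fun x y => (c < len (x^-1 * y)%g)%N) s & F `<=` ball_union c s].
Proof.
move=> cF m0 mc.
pose P n := `[< exists s, [/\ size s = n, {in s, forall x, F x} &
  pairwise (fun x y => (c < len (x^-1 * y)%g)%N) s] >].
have exP : exists n, P n by exists 0%N; apply/asboolP; exists [::].
have cFm := compact_mulg _ _ cF (compact_word_ball m).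
pose M := (fine (lambda [set (x * y)%g | x in F & y in word_ball m]) /
  fine (lambda (word_ball m))).
have bm : 0 < fine (lambda (word_ball m)).
  by apply: fine_gt0; rewrite m0 -ge0_fin_numE ?haar_compact_fin //;
    exact: compact_word_ball.
have Pbound n : P n -> (n <= Num.bound M)%N.
  move=> /asboolP[s [<- sF sep]]; rewrite -(ler_nat R); apply: ltW.
  apply: le_lt_trans (archi_boundP _); last first.
    by rewrite divr_ge0 ?fine_ge0.
  rewrite ler_pdivlMr // -lee_fin EFinM !fineK; last 2 first.
  - exact: haar_compact_fin.
  - by apply: haar_compact_fin; exact: compact_word_ball.
  rewrite -haar_ball_union_separated.
    apply: le_measure; rewrite ?inE.
    + by apply: compact_measurable; exact: compact_ball_union.
    + exact: compact_measurable.
    + exact: ball_union_subset.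
  by apply: sub_pairwise sep => x y; exact: leq_ltn_trans.
have [n /asboolP[s [sn sF sep]] n_max] := ex_maxnP exP Pbound.
(* A point of [F] outside the [c]-neighbourhood of [s] could be added to [s], against maximality. *)
exists s; split=> // x Fx; apply: contrapT => xs.
suff : (n.+1 <= n)%N by rewrite ltnn.
apply: n_max; apply/asboolP; exists (x :: s); split; first by rewrite /= sn.
  by move=> y; rewrite inE => /orP[/eqP ->|/sF].
rewrite /= sep andbT; apply/allP => y ys; rewrite ltnNge; apply/negP => yx.
apply: xs; exists y => //; rewrite /word_ball /=.
by rewrite -(word_lengthV S S_generates) invgM invgK.
Qed.

End haar_packing.

(** * Descendants counted against Haar measure *)

Theorem corollaryC (R : realType) (G : topologicalGroupType) (S : set G)
    (lambda : {measure set (borel G) -> \bar R}) :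
  hausdorff_space G -> locally_compact [set: G] ->
  compact S -> generates S ->
  gromov_hyperbolic (word_metric R S) ->
  connected [set: gromov_boundary (word_metric R S)] ->
  (exists xi eta : gromov_boundary (word_metric R S), xi <> eta) ->
  left_haar_measure lambda ->
  ~ geometrically_amenable lambda.
Proof.
move=> hG _ cS gS hyp conn [xi [eta xe]] haar amen.
have [zeta [xz ez]] := connected_boundary_third_point _ _ _ _ _ conn xe.
have [C C0 children] :=
  word_metric_two_children S gS R _ _ _ hyp xe xz ez.
have [delta delta0 hypd] := hyp; have dm := word_metric_is_metric S gS R.
have cb := compact_word_ball S cS gS.
have fin K := haar_compact_fin lambda haar K.
have [m m0] := haar_word_ball_gt0 S lambda hG cS gS haar.
(* Points more than [2 * m] apart have disjoint balls of radius [m]. *)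
pose r : R := (2 * m)%:R.
have r0 : 0 <= r by exact: ler0n.
pose L := Num.bound (4 * C + 8 * delta + r).
have Lbig : 4 * C + 8 * delta + r < L%:R by apply: archi_boundP; lra.
(* The second summand exceeds the constant of [common_descendant]; the first ensures [2 * m <= c]
   for [compact_net]. *)
pose c := (2 * m + Num.bound (2 * C + 4 * delta + 3 * r))%N.
have cbig : 2 * C + 4 * delta + 3 * r < c%:R.
  rewrite natrD; have : 2 * C + 4 * delta + 3 * r <
      (Num.bound (2 * C + 4 * delta + 3 * r))%:R by apply: archi_boundP; lra.
  by rewrite /r in r0 *; lra.
pose bm := fine (lambda (word_ball S m)); pose bc := fine (lambda (word_ball S c)).
have bm0 : 0 < bm by apply: fine_gt0; rewrite m0 -ge0_fin_numE ?fin.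
have bc0 : 0 <= bc by exact: fine_ge0.
(* The factor [2] is [1 + eps] for [eps = 1]. As [c] was fixed before [n], the power [2 ^ n] can
   outgrow the ratio of the two ball measures. *)
pose n := Num.bound (2 * bc / bm).
have nbig : 2 * bc < (2 ^ n)%:R * bm.
  rewrite -ltr_pdivrMr //; apply: lt_trans (archi_boundP _) _.
    by rewrite divr_ge0 ?mulr_ge0 // ltW.
  by rewrite ltr_nat; exact: ltn_expl.
(* A descendant [y] of [a] satisfies [d a y = n * L + 2 * gp 1 y a], and the product is at most
   [C + delta]. *)
pose k := Num.bound (n%:R * L%:R + 2 * C + 2 * delta).
have kbig : n%:R * L%:R + 2 * C + 2 * delta < k%:R.
  by apply: archi_boundP; rewrite !addr_ge0 ?mulr_ge0.
have [F [cF F0 FK]] := amen (word_ball S (k + m)) 1 (cb _) ltr01.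
have [s [sF sep Fs]] := compact_net S lambda hG cS gS haar F m c cF m0 (leq_addr _ _).
have sep' : pairwise (fun x y => 2 * C + 4 * delta + 3 * r < word_metric R S x y) s.
  apply: sub_pairwise sep => x y xy; apply: lt_trans cbig _.
  by rewrite ltr_nat.
have [t [szt tD tsep]] := spread_descendants _ _ dm delta0 hypd 1%g C L%:R r C0 r0 Lbig
  (children L) n s sep'.
have tsep' : pairwise (fun x y => (2 * m < word_length S (x^-1 * y)%g)%N) t.
  by apply: sub_pairwise tsep => x y; rewrite ltr_nat.
have tF : ball_union S m t `<=` [set (x * y)%g | x in F & y in word_ball S (k + m)].
  move=> z [y /tD[a as_ [hy gy]] yz]; exists a; first exact: sF.
  exists (a^-1 * z)%g; last by rewrite mulVKg.
  have ay : (word_length S (a^-1 * y)%g <= k)%N.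
    rewrite -(ler_nat R); apply: ltW; apply: le_lt_trans kbig.
    have [_ dC _] := dm; move: gy; rewrite /gromov_product hy (dC y a).
    by rewrite /word_metric; lra.
  rewrite /word_ball /=; have := word_lengthM S gS (a^-1 * y) (y^-1 * z)%g.
  rewrite mulgA mulgK => /leq_trans -> //; exact: leq_add.
(* Positive measure of [F] excludes an empty net, so [size s] can be cancelled at the end. *)
have s0 : (0 < size s)%N.
  case: s Fs {sF sep sep' szt tD} => // Fs.
  by move: F0; rewrite (_ : F = set0) ?measure0 ?ltxx //; apply/seteqP; split=> x // /Fs [].
have lower : ((2 ^ n * size s)%:R%:E * lambda (word_ball S m) <= 2%:E * lambda F)%E.
  rewrite -szt -(haar_ball_union_separated S lambda hG cS gS haar _ _ tsep').
  apply: le_trans FK; apply: le_measure; rewrite ?inE //.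
    by apply: compact_measurable => //; exact: compact_ball_union.
  by apply: compact_measurable => //; exact: compact_mulg.
have upper : (lambda F <= (size s)%:R%:E * lambda (word_ball S c))%E.
  apply: le_trans (haar_ball_union_le S lambda hG cS gS haar _ _).
  apply: le_measure; rewrite ?inE //; first exact: compact_measurable.
  by apply: compact_measurable => //; exact: compact_ball_union.
have : ((2 ^ n)%:R * bm * (size s)%:R <= 2 * bc * (size s)%:R).
  rewrite -lee_fin mulrAC -natrM -!mulrA (mulrC bc) !EFinM !fineK ?fin //.
  by apply: le_trans lower _; apply: lee_wpmul2l.
by rewrite ler_pM2r ?ltr0n // leNgt nbig.
Qed.
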